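(* The group $\Gamma=\langle a,t\rangle$ is a just-infinite fractal group, is regular branch over its commutator subgroup $\Gamma'$, and has the congruence property.
   Context: Let $\Sigma=\{0,1,2\}$ and let $\mathcal T_3=\Sigma^*$ be the ternary rooted tree; automorphisms act on the left on finite words. For a letter $x$ let $\overline x=x+1\bmod 3$. The automorphism $a$ is given by $a(x\sigma)=\overline x\sigma$. The automorphism $t$ is defined recursively (fixing all first-level vertices) by $t(0x\sigma)=0\overline x\sigma$, $t(1x\sigma)=1x\sigma$, $t(2\sigma)=2t(\sigma)$. $\Gamma$ is the subgroup of $\operatorname{Aut}(\mathcal T_3)$ generated by $a$ and $t$. For $G<\operatorname{Aut}(\mathcal T_3)$: $\operatorname{Stab}_G(\sigma)$ is the stabilizer of the vertex $\sigma$, $\operatorname{Stab}_G(n)=\bigcap_{\sigma\in\Sigma^n}\operatorname{Stab}_G(\sigma)$. If $g$ fixes $\sigma$, $g_{|\sigma}$ is defined by $g(\sigma\tau)=\sigma\,g_{|\sigma}(\tau)$, and $\phi(h)=(h_{|0},h_{|1},h_{|2})$ for $h$ fixing the first level. $G$ is just-infinite if it is infinite and all its quotients by non-trivial normal subgroups are finite; fractal if $\operatorname{Stab}_G(\sigma)_{|\sigma}=G$ for every vertex $\sigma$ (identifying the subtree at $\sigma$ with the whole tree); regular branch over $K$ if $K<\operatorname{Stab}_G(1)$ is a finite-index normal subgroup of $G$ with $K\times K\times K<\phi(K)$; and has the congruence property if every finite-index subgroup of $G$ contains $\operatorname{Stab}_G(n)$ for some $n$ large enough. *)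

(* Defs.v *)
From HB Require Import structures.
From mathcomp Require Import all_boot.
From mathcomp Require Import boolp classical_sets cardinality.

Set Implicit Arguments.
Unset Strict Implicit.
Unset Printing Implicit Defensive.

Local Open Scope classical_set_scope.
Local Open Scope group_scope.

Section Subgroups.
Variable gT : groupType.
Implicit Types G H K N X : set gT.

Definition is_subgroup H : Prop :=
  [/\ H 1, forall x y, H x -> H y -> H (x * y) & forall x, H x -> H x^-1].

Definition generated X : set gT := smallest is_subgroup X.

Definition commutator_subgroup G : set gT :=
  generated [set z | exists x y, [/\ G x, G y & z = [~ x, y]]].

Definition is_subgroup_of H G : Prop := is_subgroup H /\ H `<=` G.

Definition is_normal_subgroup N G : Prop :=
  is_subgroup_of N G /\ forall g x, G g -> N x -> N (x ^ g).

Definition left_cosets G H : set (set gT) :=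
  [set [set g * h | h in H] | g in G].

Definition finite_index H G : Prop := finite_set (left_cosets G H).

Definition just_infinite G : Prop :=
  infinite_set G /\
  forall N, is_normal_subgroup N G -> N <> [set 1] -> finite_set (left_cosets G N).

End Subgroups.

(* The vertices of the ternary rooted tree are the words over {0, 1, 2}; the  *)
(* children of w are the words rcons w x.                                     *)
Definition letter := 'I_3.
Definition word := seq letter.

Definition is_tree_aut (f : word -> word) : Prop :=
  [/\ bijective f, f [::] = [::] &
      forall w x, exists y, f (rcons w x) = rcons (f w) y].

Record tree_aut := TreeAut {
  tree_aut_fun :> word -> word;
  tree_autP : is_tree_aut tree_aut_fun }.

Lemma tree_aut_eq (f g : tree_aut) : (forall w, f w = g w) -> f = g.
Proof.
case: f g => [f fP] [g gP] /= /funext fg; subst g.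
by rewrite (Prop_irrelevance fP gP).
Qed.

Lemma tree_aut_size (f : tree_aut) w : size (f w) = size w.
Proof.
have [_ f0 fS] := tree_autP f; elim/last_ind: w => [|w x IHw]; first by rewrite f0.
by have [y ->] := fS w x; rewrite !size_rcons IHw.
Qed.

Lemma tree_aut_cat (f : tree_aut) u v :
  f (u ++ v) = f u ++ drop (size u) (f (u ++ v)).
Proof.
have [_ f0 fS] := tree_autP f.
suff [w fw] : exists w, f (u ++ v) = f u ++ w.
  by rewrite fw drop_size_cat ?tree_aut_size.
elim/last_ind: v => [|v x [w IHv]]; first by exists [::]; rewrite !cats0.
have [y fy] := fS (u ++ v) x; exists (rcons w y).
by rewrite -rcons_cat fy IHv rcons_cat.
Qed.

Lemma id_is_tree_aut : is_tree_aut id.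
Proof. by split=> // [|w x]; [exists id | exists x]. Qed.

Lemma comp_is_tree_aut (f g : tree_aut) : is_tree_aut (f \o g).
Proof.
have [fB f0 fS] := tree_autP f; have [gB g0 gS] := tree_autP g.
split=> [||w x]; [exact: bij_comp | by rewrite /= g0 |].
by have [y /= ->] := gS w x; exact: fS.
Qed.

Lemma tree_aut_inv_ex (f : tree_aut) :
  exists g : word -> word, cancel f g /\ cancel g f.
Proof. by have [[g fK gK] _ _] := tree_autP f; exists g. Qed.

Definition tree_aut_inv_fun (f : tree_aut) : word -> word :=
  projT1 (cid (tree_aut_inv_ex f)).

Lemma tree_aut_funK (f : tree_aut) : cancel f (tree_aut_inv_fun f).
Proof. by rewrite /tree_aut_inv_fun; case: cid => g []. Qed.

Lemma tree_aut_inv_funK (f : tree_aut) : cancel (tree_aut_inv_fun f) f.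
Proof. by rewrite /tree_aut_inv_fun; case: cid => g []. Qed.

Lemma inv_is_tree_aut (f : tree_aut) : is_tree_aut (tree_aut_inv_fun f).
Proof.
have [_ f0 fS] := tree_autP f; have fK := tree_aut_funK f.
have Kf := tree_aut_inv_funK f; split=> [||w x]; first by exists f.
  by rewrite -{1}f0 fK.
have := Kf (rcons w x); case/lastP: (tree_aut_inv_fun f (rcons w x)) => [|v y].
  by rewrite f0; case: w.
have [z ->] := fS v y => /rcons_inj[<- _].
by exists y; rewrite fK.
Qed.

Definition tree_aut_one : tree_aut := TreeAut id_is_tree_aut.
Definition tree_aut_mul (f g : tree_aut) : tree_aut :=
  TreeAut (comp_is_tree_aut f g).
Definition tree_aut_inv (f : tree_aut) : tree_aut :=
  TreeAut (inv_is_tree_aut f).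

Lemma tree_aut_mulA : associative tree_aut_mul.
Proof. by move=> f g h; apply: tree_aut_eq. Qed.
Lemma tree_aut_mul1 : left_id tree_aut_one tree_aut_mul.
Proof. by move=> f; apply: tree_aut_eq. Qed.
Lemma tree_aut_1mul : right_id tree_aut_one tree_aut_mul.
Proof. by move=> f; apply: tree_aut_eq. Qed.
Lemma tree_aut_mulV : left_inverse tree_aut_one tree_aut_inv tree_aut_mul.
Proof. by move=> f; apply: tree_aut_eq => w /=; rewrite tree_aut_funK. Qed.
Lemma tree_aut_Vmul : right_inverse tree_aut_one tree_aut_inv tree_aut_mul.
Proof. by move=> f; apply: tree_aut_eq => w /=; rewrite tree_aut_inv_funK. Qed.

HB.instance Definition _ := gen_eqMixin tree_aut.
HB.instance Definition _ := gen_choiceMixin tree_aut.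
(* Automorphisms act on the left: (f * g) w = f (g w). *)
HB.instance Definition _ := isGroup.Build tree_aut
  tree_aut_mulA tree_aut_mul1 tree_aut_1mul tree_aut_mulV tree_aut_Vmul.

Definition section_fun (f : tree_aut) (s w : word) : word :=
  drop (size s) (f (s ++ w)).

Lemma section_funE (f : tree_aut) s w : f (s ++ w) = f s ++ section_fun f s w.
Proof. exact: tree_aut_cat. Qed.

Lemma section_funK (f g : tree_aut) s :
  cancel f g -> cancel (section_fun f s) (section_fun g (f s)).
Proof.
move=> fK w; rewrite {1}/section_fun -section_funE fK.
by rewrite tree_aut_size drop_size_cat.
Qed.

Lemma section_is_tree_aut (f : tree_aut) s : is_tree_aut (section_fun f s).
Proof.
have [_ f0 fS] := tree_autP f; split=> [||w x].
- exists (section_fun (tree_aut_inv f) (f s)).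
    exact/section_funK/tree_aut_funK.
  have := @section_funK (tree_aut_inv f) f (f s) (tree_aut_inv_funK f).
  by rewrite /= tree_aut_funK.
- by rewrite /section_fun cats0 -(tree_aut_size f s) drop_size.
- have [y fy] := fS (s ++ w) x; exists y.
  rewrite /section_fun -rcons_cat fy -!cats1 drop_cat tree_aut_size size_cat.
  case: ltnP => //; rewrite -{2}[size s]addn0 leq_add2l leqn0 => /nilP->.
  by rewrite cats0 addn0 subnn -(tree_aut_size f s) drop_size.
Qed.

(* By section_funE, if f fixes s then tree_section f s is the automorphism    *)
(* g such that f (s ++ w) = s ++ g w; it is only used for such f and s.       *)
Definition tree_section (f : tree_aut) (s : word) : tree_aut :=
  TreeAut (section_is_tree_aut f s).

Definition vertex_stab (G : set tree_aut) (s : word) : set tree_aut :=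
  [set g | G g /\ g s = s].

Definition level_stab (G : set tree_aut) (n : nat) : set tree_aut :=
  \bigcap_(s in [set s : word | size s = n]) vertex_stab G s.

Definition letter0 : letter := @Ordinal 3 0 isT.
Definition letter1 : letter := @Ordinal 3 1 isT.
Definition letter2 : letter := @Ordinal 3 2 isT.

Definition phi (h : tree_aut) : tree_aut * tree_aut * tree_aut :=
  (tree_section h [:: letter0], tree_section h [:: letter1],
   tree_section h [:: letter2]).

Definition fractal (G : set tree_aut) : Prop :=
  forall s : word, [set tree_section g s | g in vertex_stab G s] = G.

Definition regular_branch_over (G K : set tree_aut) : Prop :=
  [/\ is_normal_subgroup K G, K `<=` level_stab G 1, finite_index K G &
      K `*` K `*` K `<=` phi @` K].

Definition congruence_property (G : set tree_aut) : Prop :=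
  forall H, is_subgroup_of H G -> finite_index H G ->
    exists n : nat, level_stab G n `<=` H.

(* ordS x is x + 1 mod 3. *)
Definition a_fun (w : word) : word :=
  if w is x :: s then ordS x :: s else [::].

Fixpoint t_fun (w : word) : word :=
  match w with
  | [::] => [::]
  | y :: w' =>
      match val y with
      | 0 => if w' is x :: s then y :: ordS x :: s else [:: y]
      | 1 => y :: w'
      | _ => y :: t_fun w'
      end
  end.

Lemma ordS3 (x : letter) : ordS (ordS (ordS x)) = x.
Proof. by apply: val_inj; case: x => [[|[|[|]]]]. Qed.

Lemma a_fun3 w : a_fun (a_fun (a_fun w)) = w.
Proof. by case: w => //= x s; rewrite ordS3. Qed.

Lemma t_fun3 w : t_fun (t_fun (t_fun w)) = w.
Proof.
elim: w => //= -[[|[|[|//]]] y3] w IHw //=; last by rewrite IHw.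
by case: w {IHw} => //= x s; rewrite ordS3.
Qed.

Lemma a_is_tree_aut : is_tree_aut a_fun.
Proof.
split=> // [|[|z w] x]; first by exists (a_fun \o a_fun); exact: a_fun3.
  by exists (ordS x).
by exists x.
Qed.

Lemma t_is_tree_aut : is_tree_aut t_fun.
Proof.
split=> // [|w x]; first by exists (t_fun \o t_fun); exact: t_fun3.
elim: w => [|[[|[|[|//]]] y3] w [z IHw]] /=.
- by exists x; case: x => [[|[|[|]]]].
- by case: w {IHw} => [|u w]; [exists (ordS x) | exists x].
- by exists x.
- by exists z; rewrite IHw.
Qed.

Definition aut_a : tree_aut := TreeAut a_is_tree_aut.
Definition aut_t : tree_aut := TreeAut t_is_tree_aut.

Definition Gamma : set tree_aut := generated [set aut_a; aut_t].

Lemma aut_a_cons x s : aut_a (x :: s) = ordS x :: s. Proof. by []. Qed.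
Lemma aut_t_cons0 x s :
  aut_t [:: letter0, x & s] = [:: letter0, ordS x & s].
Proof. by []. Qed.
Lemma aut_t_cons1 x s : aut_t [:: letter1, x & s] = [:: letter1, x & s].
Proof. by []. Qed.
Lemma aut_t_cons2 s : aut_t (letter2 :: s) = letter2 :: aut_t s.
Proof. by []. Qed.

(* Main.v *)
Require Import Defs.
From mathcomp Require Import all_boot.
From mathcomp Require Import boolp classical_sets cardinality.

Set Implicit Arguments.
Unset Strict Implicit.
Unset Printing Implicit Defensive.

Local Open Scope classical_set_scope.
Local Open Scope group_scope.

(** Write G for Gamma, G' and G'' for its first two derived subgroups and G3
    for [G', G]; (g0, g1, g2) denotes the automorphism fixing the first level
    with these three sections.  Everything except infiniteness and fractality
    follows from one fact: every non-trivial normal subgroup N of G contains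
    the stabiliser in G of some level ([normal_level_stab]).  Level stabilisers
    have finite index, so G is just-infinite.  A finite-index subgroup H of the
    infinite group G has a non-trivial normal core, to which the fact applies,
    so G has the congruence property.

    The conjugates of t by powers of a are t = (a, 1, t), t1 = (1, t, a) and
    t2 = (t, a, 1).  The quotients t^-1 t1, t1^-1 t2 and t2^-1 t lie in G', and
    their sections at each vertex of the first level include t and a^-1; so
    every element of G is the section at a given vertex of some element of G'
    fixing the first level ([Gamma'_lift]).  Fractality and level transitivity,
    hence infiniteness, follow.

    The inclusions behind the main fact are the following.
    - G' x G' x G' lies in G3 ([at1_gamma3]): ([a, t], 1, 1) = [t, t2] is the
      commutator of an element with a conjugate of itself, hence in G3, and G'
      is the normal closure of [a, t].  In particular G' x G' x G' lies in G',
      which is the branching property.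
    - G3 x G3 x G3 lies in G'' ([at1_Gamma'']): for k in G' and g in G, pick an
      element of G' with section g at the first vertex; its commutator with
      (k, 1, 1) is ([k, g], 1, 1).
    - The stabiliser of level 2 lies in G3 ([level_stab2_gamma3]): an element of
      the stabiliser of level 1 has sections congruent modulo G' to a^i t^j,
      a^j t^k and a^k t^i ([Gamma_pattern]).  If it fixes level 2 then i, j and k
      are divisible by 3, so all three sections are in G'.
    - Hence the stabiliser of level 3 lies in G'' ([level_stab3_Gamma'']).

    Now let N contain some g moving a vertex v of level n.  For k and l in G',
    let k_v and l_v be the copies of k and l acting below v.  As g moves v, the
    conjugate of k_v by g commutes with l_v, which gives
    [[g, k_v], l_v] = [k_v, l_v].  So N contains the copy of G'' below v, hence
    below every vertex of level n by transitivity.  An element of the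
    stabiliser of level n + 3 is the product of copies of its sections at
    level n, which fix level 3 and so are in G''; therefore it lies in N. *)

(** * Subgroups, commutators and cosets *)

Section Subgroups.
Variable gT : groupType.
Implicit Types (G H K L N X : set gT) (g h x y z : gT).

Definition normalised L G : Prop := forall g x, G g -> L x -> L (x ^ g).

Definition commutator_of H K : set gT :=
  generated [set z | exists x y, [/\ H x, K y & z = [~ x, y]]].

Lemma generated_subgroup X : is_subgroup (generated X).
Proof.
split=> [A [[]] //|x y Xx Xy A AX|x Xx A AX].
- by have [[_ AM _] _] := AX; apply: AM; [apply: Xx | apply: Xy].
- by have [[_ _ AV] _] := AX; apply: AV; apply: Xx.
Qed.

Lemma sub_generated X : X `<=` generated X.
Proof. by move=> x Xx A [_ XA]; apply: XA. Qed.

Lemma generated_min X H : is_subgroup H -> X `<=` H -> generated X `<=` H.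
Proof. by move=> sgH XH x; apply. Qed.

Lemma subgroupJ H g x : is_subgroup H -> H g -> H x -> H (x ^ g).
Proof. by case=> _ HM HV Hg Hx; apply: (HM); [apply: HV | apply: HM]. Qed.

Lemma subgroupR H x y : is_subgroup H -> H x -> H y -> H [~ x, y].
Proof.
move=> sgH Hx Hy; have [_ HM HV] := sgH.
by apply: HM; [apply: HV | apply: subgroupJ].
Qed.

Lemma subgroupX H x n : is_subgroup H -> H x -> H (x ^+ n).
Proof.
by case=> H1 HM _ Hx; elim: n => // n IHn; rewrite expgS; apply: HM.
Qed.

Lemma commMgJ x y z : [~ x * y, z] = [~ x, z] ^ y * [~ y, z].
Proof. by rewrite /commg /conjg !gnorm. Qed.

Lemma commVg x y : [~ x^-1, y] = [~ y, x] ^ x^-1.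
Proof. by rewrite /commg /conjg !gnorm. Qed.

(** In [~ g, x] = x^-1 ^ g * x only the second factor fails to commute with y.
    The point is that a normal subgroup containing g contains the left-hand
    side, hence also [~ x, y], in which g does not occur. *)
Lemma commg_commgl g x y :
  commute (x^-1 ^ g) y -> [~ [~ g, x], y] = [~ x, y].
Proof.
move=> /commgP/eqP com; have -> : [~ g, x] = x^-1 ^ g * x.
  by rewrite /commg /conjg !gnorm.
by rewrite commMgJ com conj1g mul1g.
Qed.

Lemma mem_commutator H K x y : H x -> K y -> commutator_of H K [~ x, y].
Proof. by move=> Hx Ky; apply: sub_generated; exists x, y. Qed.

Lemma commutator_of_normalised H K G :
  normalised H G -> normalised K G -> normalised (commutator_of H K) G.
Proof.
move=> nHG nKG g z Gg; have [c1 cM cV] := generated_subgroup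
  [set z | exists x y, [/\ H x, K y & z = [~ x, y]]].
apply: (@generated_min _ [set z | commutator_of H K (z ^ g)]) => [|_ [x [y [Hx Ky ->]]]].
  split=> /= [|x y|x]; rewrite ?conj1g ?conjMg ?conjVg //; [exact: cM | exact: cV].
by rewrite /= conjRg; apply: mem_commutator; [apply: nHG | apply: nKG].
Qed.

Lemma subgroup_normalised H : is_subgroup H -> normalised H H.
Proof. by move=> sgH g x; apply: subgroupJ. Qed.

Lemma commutator_of_min H K L :
  is_subgroup L -> (forall x y, H x -> K y -> L [~ x, y]) -> commutator_of H K `<=` L.
Proof. by move=> sgL LHK; apply: generated_min => // _ [x [y [Hx Ky ->]]]; apply: LHK. Qed.

(** Modulo a normalised subgroup L, commuting with a given element is a
    subgroup condition; so commutation of the generators propagates, one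
    argument at a time, to the whole generated subgroup. *)
Lemma derived_generated_min X L :
    is_subgroup L -> normalised L (generated X) ->
    (forall x y, X x -> X y -> L [~ x, y]) ->
  commutator_subgroup (generated X) `<=` L.
Proof.
move=> sgL nLX LXX; have [L1 LM LV] := sgL.
have [g1 gM gV] := generated_subgroup X.
have centr (Y : set gT) : (forall x y, X x -> Y y -> L [~ x, y]) ->
    forall x y, generated X x -> Y y -> L [~ x, y].
  move=> LXY x y /(_ (generated X `&` [set x | forall y, Y y -> L [~ x, y]])).
  case=> [|_]; last exact.
  split=> [|z Xz]; last by split=> [|y' Yy]; [apply: sub_generated | apply: LXY].
  split=> [|x1 x2 [Xx1 Lx1] [Xx2 Lx2]|x1 [Xx1 Lx1]].
  - by split=> // y' _; rewrite comm1g.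
  - split=> [|y' Yy]; first exact: gM.
    by rewrite commMgJ; apply: LM; [apply: nLX => //; apply: Lx1 | apply: Lx2].
  - split=> [|y' Yy]; first exact: gV.
    by rewrite commVg -invgR; apply: nLX; [apply: gV | apply/LV/Lx1].
apply: commutator_of_min => //; apply: (centr) => x y Xx Xy.
by rewrite -invgR; apply: LV; apply: (centr X).
Qed.

Lemma normal_core_normal G H : is_subgroup G -> is_subgroup_of H G ->
  is_normal_subgroup [set x | forall g, G g -> H (x ^ g)] G.
Proof.
move=> [G1 GM _] [[H1 HM HV] HG]; split=> [|g x Gg Nx h Gh /=]; last first.
  by rewrite -conjgM; apply/Nx/GM.
split=> [|x /(_ 1 G1)]; last by rewrite conjg1 => /HG.
split=> [g _|x y Nx Ny g Gg|x Nx g Gg]; rewrite ?conj1g ?conjMg ?conjVg //.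
- by apply: HM; [apply: Nx | apply: Ny].
- by apply/HV/Nx.
Qed.

Lemma left_coset_eq H x y : is_subgroup H ->
  [set x * h | h in H] = [set y * h | h in H] -> H (x^-1 * y).
Proof.
move=> [H1 HM HV] xHyH; have [h Hh <-] : [set x * h | h in H] y.
  by rewrite xHyH; exists 1; rewrite ?mulg1.
by rewrite mulKg.
Qed.

(** The action of G on the finitely many cosets of H has the normal core of H
    as kernel; if the core were trivial, the infinite group G would embed in a
    finite set.  An element acts here through the graph of its permutation of a
    list s enumerating the cosets, so that the target is a finite type. *)
Lemma normal_core_nontrivial G H : infinite_set G -> is_subgroup G ->
    is_subgroup_of H G -> finite_index H G ->
  [set x | forall g, G g -> H (x ^ g)] <> [set 1].
Proof.
move=> infG [G1 GM GV] [sgH HG] /finite_seqP[s cosetsE] core1; apply: infG.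
have coset_s g : G g -> exists i : 'I_(size s), nth set0 s i = [set g * h | h in H].
  move=> Gg; have: [set` s] [set g * h | h in H] by rewrite -cosetsE; exists g.
  by move=> sgH'; exists (Ordinal (etrans (index_mem _ _) sgH')); apply: nth_index.
pose act g := [ffun ij : 'I_(size s) * 'I_(size s) =>
  `[< nth set0 s ij.2 = [set g * x | x in nth set0 s ij.1] >]].
have act_inj : {in G &, injective act}.
  move=> g1 g2; rewrite !inE => Gg1 Gg2 eq12.
  suff /mulg1_eq : g1^-1 * g2 = 1 by rewrite invgK.
  suff: [set 1] (g1^-1 * g2) by [].
  rewrite -core1 => h Gh /=.
  have [i si] := coset_s h Gh; have [j sj] := coset_s (g1 * h) (GM _ _ Gg1 Gh).
  have cosetM g : [set g * x | x in [set h * k | k in H]] = [set g * h * k | k in H].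
    apply/seteqP; split=> [_ [_ [k Hk <-] <-]|_ [k Hk <-]].
      by exists k; rewrite ?mulgA.
    by exists (h * k); [exists k | rewrite mulgA].
  have := congr1 (fun f : {ffun _ -> bool} => f (i, j)) eq12.
  rewrite !ffunE /= si sj !cosetM asboolT // => /esym/asboolP.
  move=> /left_coset_eq - /(_ sgH).
  by rewrite /conjg invgM !mulgA.
rewrite -(eq_finite_set (inj_card_eq act_inj)); exact: finite_finset.
Qed.


End Subgroups.

(** * Sections and automorphisms fixing the first level *)

Implicit Types (f g h k l : tree_aut) (s u v w : word) (x y : letter).

Lemma aut_nil f : f [::] = [::].
Proof. by apply/size0nil; rewrite tree_aut_size. Qed.

Lemma aut_fix_prefix f u v : f (u ++ v) = u ++ v -> f u = u.
Proof.
rewrite tree_aut_cat => /(congr1 (take (size u))).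
by rewrite !take_size_cat ?tree_aut_size.
Qed.

Lemma section1 s : tree_section 1 s = 1.
Proof. by apply: tree_aut_eq => w; apply: drop_size_cat. Qed.

Lemma sectionM f g s :
  tree_section (f * g) s = tree_section f (g s) * tree_section g s.
Proof.
apply: tree_aut_eq => w /=; rewrite /section_fun /= tree_aut_size.
by rewrite -[drop (size s) (g _)]/(section_fun g s w) -section_funE.
Qed.

Lemma sectionV f s : tree_section f^-1 s = (tree_section f (f^-1 s))^-1.
Proof.
apply/esym/mulg1_eq; have := sectionM f f^-1 s.
by rewrite mulgV section1 => <-.
Qed.

Lemma section_nil f : tree_section f [::] = f.
Proof. by apply: tree_aut_eq => w; rewrite /= /section_fun drop0. Qed.

Lemma section_cat f s w : tree_section f (s ++ w) = tree_section (tree_section f s) w.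
Proof.
by apply: tree_aut_eq => u; rewrite /= /section_fun -catA drop_drop size_cat addnC.
Qed.

Lemma level_stabP (G : set tree_aut) n g :
  level_stab G n g <-> G g /\ forall s, size s = n -> g s = s.
Proof.
split=> [Sg|[Gg Sg] s sn]; last by split=> //; apply: Sg.
split=> [|s sn]; first by have [] := Sg (nseq n letter0) (size_nseq _ _).
by have [] := Sg s sn.
Qed.

(** [branch f] is the preimage under phi of the triple of values of f.
    Indexing by letters rather than by triples lets all group operations be
    computed pointwise. *)
Definition branch_fun (f : letter -> tree_aut) (w : word) : word :=
  if w is x :: s then x :: f x s else [::].

Lemma branch_is_tree_aut (f : letter -> tree_aut) : is_tree_aut (branch_fun f).
Proof.
split=> // [|[|z w] x].
- exists (branch_fun (fun x => (f x)^-1)) => -[|x w] //=; congr (_ :: _).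
    exact: tree_aut_funK.
  exact: tree_aut_inv_funK.
- by exists x; rewrite /= aut_nil.
- have [_ _ fS] := tree_autP (f z); have [y fy] := fS w x.
  by exists y; rewrite /= fy.
Qed.

Definition branch (f : letter -> tree_aut) : tree_aut :=
  TreeAut (branch_is_tree_aut f).

Lemma branch_ext (f g : letter -> tree_aut) :
  (forall x, f x = g x) -> branch f = branch g.
Proof. by move=> fg; congr branch; apply/funext. Qed.

Lemma branch1 : branch (fun=> 1) = 1.
Proof. by apply: tree_aut_eq => -[]. Qed.

Lemma branchM (f g : letter -> tree_aut) :
  branch f * branch g = branch (fun x => f x * g x).
Proof. by apply: tree_aut_eq => -[]. Qed.

Lemma branchV (f : letter -> tree_aut) : (branch f)^-1 = branch (fun x => (f x)^-1).
Proof.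
apply: mulg1_eq; rewrite branchM -branch1; apply: branch_ext => x.
exact: mulgV.
Qed.

Lemma branchJ (f g : letter -> tree_aut) :
  branch f ^ branch g = branch (fun x => f x ^ g x).
Proof. by rewrite /conjg branchV !branchM. Qed.

Lemma branchR (f g : letter -> tree_aut) :
  [~ branch f, branch g] = branch (fun x => [~ f x, g x]).
Proof. by rewrite /commg branchJ branchV branchM. Qed.

Lemma section_branch (f : letter -> tree_aut) x s :
  tree_section (branch f) (x :: s) = tree_section (f x) s.
Proof. by apply: tree_aut_eq. Qed.

Lemma branch_section g : (forall x, g [:: x] = [:: x]) ->
  g = branch (fun x => tree_section g [:: x]).
Proof.
move=> g1; apply: tree_aut_eq => -[|x w]; first exact: aut_nil.
by have := section_funE g [:: x] w; rewrite g1.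
Qed.

(** * Copies of an automorphism below a vertex *)

Definition at1 x k : tree_aut := branch (fun y => if y == x then k else 1).

Lemma at11 x : at1 x 1 = 1.
Proof. by rewrite -[RHS]branch1; apply: branch_ext => y; case: ifP. Qed.

Lemma at1M x k l : at1 x (k * l) = at1 x k * at1 x l.
Proof. by rewrite branchM; apply: branch_ext => y /=; case: eqP; rewrite ?mulg1. Qed.

Lemma at1V x k : at1 x k^-1 = (at1 x k)^-1.
Proof. by rewrite branchV; apply: branch_ext => y /=; case: eqP; rewrite ?invg1. Qed.

Lemma at1_conj x k (f : letter -> tree_aut) : at1 x k ^ branch f = at1 x (k ^ f x).
Proof.
rewrite branchJ; apply: branch_ext => y /=; case: eqP => [->|] //.
by rewrite conj1g.
Qed.

Lemma at1_comm x k (f : letter -> tree_aut) : [~ at1 x k, branch f] = at1 x [~ k, f x].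
Proof. by rewrite /commg at1_conj -at1V -at1M. Qed.

Lemma at1_subgroup (M : set tree_aut) x :
  is_subgroup M -> is_subgroup [set k | M (at1 x k)].
Proof.
move=> [M1 MM MV]; split=> /= [|k l|k]; rewrite ?at11 ?at1M ?at1V //;
  [exact: MM | exact: MV].
Qed.

Lemma letter_ind (P : letter -> Prop) :
  P letter0 -> P letter1 -> P letter2 -> forall x, P x.
Proof.
by move=> P0 P1 P2 [[|[|[|//]]] x3]; rewrite (bool_irrelevance x3 isT).
Qed.

Lemma branch_closed (M : set tree_aut) (f : letter -> tree_aut) :
  is_subgroup M -> (forall x, M (at1 x (f x))) -> M (branch f).
Proof.
move=> [_ MM _] Mf; suff -> : branch f =
    at1 letter0 (f letter0) * (at1 letter1 (f letter1) * at1 letter2 (f letter2)).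
  by apply: (MM) => //; apply: MM.
rewrite !branchM; apply: branch_ext; apply: letter_ind; rewrite /= ?mul1g ?mulg1 //.
Qed.

Definition embed v k : tree_aut := foldr at1 k v.

(** An automorphism fixing level n is the product of the copies of its sections
    below the vertices of that level.  The induction on n splits off the first
    level and replaces M by the subgroup of the k whose copy below x is in M. *)
Lemma embed_level_closed n (L M : set tree_aut) g :
    is_subgroup M -> (forall v k, size v = n -> L k -> M (embed v k)) ->
    (forall v, size v = n -> g v = v /\ L (tree_section g v)) ->
  M g.
Proof.
elim: n M g => [|n IHn] M g sgM ML gL.
  by have [_] := gL [::] erefl; rewrite section_nil => /(ML [::] _ erefl).
have g1 x : g [:: x] = [:: x].
  have [] := gL (x :: nseq n letter0); first by rewrite /= size_nseq.
  by rewrite -cat1s => /aut_fix_prefix.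
rewrite (branch_section g1); apply: branch_closed => // x.
apply: (IHn [set k | M (at1 x k)]) => [|v k vn Lk|v vn].
- exact: at1_subgroup.
- by apply: (ML (x :: v)) => //=; rewrite vn.
have [gv Lgv] := gL (x :: v) (congr1 S vn).
by rewrite -section_cat; split; rewrite //= /section_fun /= gv /= drop0.
Qed.

Lemma embedM v k l : embed v (k * l) = embed v k * embed v l.
Proof. by elim: v => //= x v ->; rewrite at1M. Qed.

Lemma embedV v k : embed v k^-1 = (embed v k)^-1.
Proof. by elim: v => //= x v ->; rewrite at1V. Qed.

Lemma embedR v k l : embed v [~ k, l] = [~ embed v k, embed v l].
Proof. by rewrite /commg /conjg !embedM !embedV. Qed.

Lemma embed1 v : embed v 1 = 1.
Proof. by elim: v => //= x v ->; rewrite at11. Qed.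

Definition supported_at v f := f v = v /\ forall u, ~~ prefix v u -> f u = u.

Lemma embed_supported v k : supported_at v (embed v k).
Proof.
elim: v => [|x v [IHv IHu]]; first by split=> [|u]; [exact: aut_nil | rewrite prefix0s].
split=> [|[|y u] /=] //=; first by rewrite eqxx IHv.
by rewrite eq_sym; case: eqP => //= _ /IHu ->.
Qed.

Lemma prefix_aut f v u : prefix v u -> prefix (f v) (f u).
Proof. by case/prefixP=> w ->; rewrite tree_aut_cat prefix_prefix. Qed.

Lemma supported_conj f g v : supported_at v f -> supported_at (g^-1 v) (f ^ g).
Proof.
have gK u : g (g^-1 u) = u by rewrite /= tree_aut_inv_funK.
have Kg u : g^-1 (g u) = u by rewrite /= tree_aut_funK.
have conjE u : (f ^ g) u = g^-1 (f (g u)) by [].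
move=> [fv fu]; split=> [|u vu]; rewrite conjE; first by rewrite gK fv.
by rewrite fu ?Kg //; apply: contra vu => /(prefix_aut g^-1); rewrite Kg.
Qed.

Lemma supported_commute f1 f2 v1 v2 : size v1 = size v2 -> v1 <> v2 ->
  supported_at v1 f1 -> supported_at v2 f2 -> commute f1 f2.
Proof.
move=> eq_size neq12 [f1v f1u] [f2v f2u]; apply: tree_aut_eq => u.
have excl w : prefix v1 w -> ~~ prefix v2 w.
  by rewrite !prefixE eq_size => /eqP->; apply/eqP.
rewrite /=; have [pu|/[dup] npu /f1u f1uE] := boolP (prefix v1 u).
  rewrite f2u ?excl // [RHS]f2u //; apply: excl.
  by rewrite -f1v; apply: prefix_aut.
rewrite f1uE; have [pu|/f2u ->//] := boolP (prefix v2 u).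
apply: f1u; apply: contraL (prefix_aut f2 pu); rewrite f2v.
exact: excl.
Qed.

(** Since g moves v, conjugation by g carries the copy of k^-1 below v to an
    automorphism supported below another vertex of the same level, which
    commutes with the copy of l; the double commutator of g with both copies
    is then the copy of [~ k, l]. *)
Lemma normal_embed_commutator (G N : set tree_aut) g v k l :
    is_normal_subgroup N G -> N g -> g v <> v ->
    G (embed v k) -> G (embed v l) ->
  N (embed v [~ k, l]).
Proof.
move=> [[[N1 NM NV] NG] nN] Ng gv Gk Gl.
rewrite embedR -(@commg_commgl _ g); last first.
  rewrite -embedV; apply: (@supported_commute _ _ (g^-1 v) v).
  - exact: tree_aut_size.
  - by move=> gVv; apply: gv; rewrite -{1}gVv /= tree_aut_inv_funK.
  - exact/supported_conj/embed_supported.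
  - exact: embed_supported.
have Nc h z : G z -> N h -> N [~ h, z].
  by move=> Gz Nh; apply: NM; [apply: NV | apply: nN].
by apply: (Nc) => //; apply: Nc.
Qed.

(** * Level stabilisers *)

Lemma level_section (G : set tree_aut) m n v g :
  (forall f s, G f -> G (tree_section f s)) -> size v = m ->
  level_stab G (m + n) g -> g v = v /\ level_stab G n (tree_section g v).
Proof.
move=> secG vm /level_stabP[Gg gfix].
have gvw w : size w = n -> g (v ++ w) = v ++ w by move=> wn; rewrite gfix // size_cat vm wn.
split; first exact/aut_fix_prefix/(gvw (nseq n letter0))/size_nseq.
apply/level_stabP; split=> [|w wn]; first exact: secG.
by rewrite /= /section_fun gvw // drop_size_cat.
Qed.

(** The coset of g modulo H only depends on the restriction r g of g to the
    words of length n, which takes finitely many values. *)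
Lemma finite_index_level_stab (G H : set tree_aut) n : is_subgroup G ->
  is_subgroup H -> level_stab G n `<=` H -> finite_index H G.
Proof.
move=> [G1 GM GV] sgH SH.
have sz g (w : n.-tuple letter) : size (g w) == n by rewrite tree_aut_size size_tuple.
pose r g : {ffun n.-tuple letter -> n.-tuple letter} := [ffun w => Tuple (sz g w)].
pose coset c := [set z | exists g h, [/\ G g, H h, r g = c & z = g * h]].
apply: (@sub_finite_set _ _ (coset @` setT)); last exact/finite_image/finite_finset.
move=> _ [g Gg <-]; exists (r g) => //; apply/seteqP; split; last first.
  by move=> _ [h Hh <-]; exists g, h.
move=> _ [g' [h [Gg' Hh rg' ->]]]; have [_ HM _] := sgH.
exists (g^-1 * g' * h); last by rewrite !mulgA mulgV mul1g.
apply: HM => //; apply: SH; apply/level_stabP; split=> [|s sn].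
  by apply: GM => //; apply: GV.
have /(congr1 (fun c : {ffun _ -> _} => tval (c (Tuple (introT eqP sn))))) := rg'.
by rewrite !ffunE /= => ->; apply: tree_aut_funK.
Qed.

(** * Generators of Gamma and of its derived subgroup *)

Notation Gamma' := (commutator_subgroup Gamma).
Notation Gamma'' := (commutator_subgroup Gamma').
Notation gamma3 := (commutator_of Gamma' Gamma).

Lemma Gamma_subgroup : is_subgroup Gamma.
Proof. exact: generated_subgroup. Qed.

Lemma Gamma_a : Gamma aut_a.
Proof. by apply: sub_generated; left. Qed.

Lemma Gamma_t : Gamma aut_t.
Proof. by apply: sub_generated; right. Qed.

Lemma Gamma'_subgroup : is_subgroup Gamma'.
Proof. exact: generated_subgroup. Qed.

Lemma Gamma''_subgroup : is_subgroup Gamma''.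
Proof. exact: generated_subgroup. Qed.

Lemma gamma3_subgroup : is_subgroup gamma3.
Proof. exact: generated_subgroup. Qed.

Lemma Gamma'_normal : normalised Gamma' Gamma.
Proof. by apply: commutator_of_normalised; exact: subgroup_normalised Gamma_subgroup. Qed.

Lemma gamma3_normal : normalised gamma3 Gamma.
Proof.
apply: commutator_of_normalised; first exact: Gamma'_normal.
exact: subgroup_normalised Gamma_subgroup.
Qed.

Lemma Gamma'_sub : Gamma' `<=` Gamma.
Proof.
apply: commutator_of_min; first exact: Gamma_subgroup.
by move=> g h; apply: subgroupR Gamma_subgroup.
Qed.

Lemma gamma3_sub : gamma3 `<=` Gamma'.
Proof.
apply: commutator_of_min; first exact: Gamma'_subgroup.
by move=> g h /Gamma'_sub Gg Gh; apply: mem_commutator.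
Qed.

(** This is the statement that [~ a, t] generates Gamma' as a normal subgroup;
    it reduces inclusions of Gamma' to one computation. *)
Lemma Gamma'_min (L : set tree_aut) :
  is_subgroup L -> normalised L Gamma -> L [~ aut_a, aut_t] -> Gamma' `<=` L.
Proof.
move=> sgL nL Lat; have [L1 _ LV] := sgL; apply: derived_generated_min => //.
by move=> g h [->|->] [->|->]; rewrite ?commgg // -invgR; apply: LV.
Qed.

Lemma aut_a3 : aut_a ^+ 3 = 1.
Proof. by apply: tree_aut_eq => w; apply: a_fun3. Qed.

Lemma aut_t3 : aut_t ^+ 3 = 1.
Proof. by apply: tree_aut_eq => w; apply: t_fun3. Qed.

Lemma aut_aV : aut_a^-1 = aut_a ^+ 2.
Proof. by apply: mulg1_eq; rewrite -expgS aut_a3. Qed.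

Definition triple f0 f1 f2 : letter -> tree_aut :=
  fun x => match val x with 0 => f0 | 1 => f1 | _ => f2 end.

Lemma t0_branch : aut_t = branch (triple aut_a 1 aut_t).
Proof.
apply: tree_aut_eq => -[|x w] //; elim/letter_ind: x => //.
by case: w.
Qed.

Lemma triple_conj_a f0 f1 f2 :
  branch (triple f0 f1 f2) ^ aut_a = branch (triple f1 f2 f0).
Proof.
rewrite /conjg aut_aV; apply: tree_aut_eq => -[|x w] //=.
by rewrite ordS3; elim/letter_ind: x.
Qed.

Definition t1 := aut_t ^ aut_a.
Definition t2 := t1 ^ aut_a.

Lemma t1_branch : t1 = branch (triple 1 aut_t aut_a).
Proof. by rewrite -triple_conj_a -t0_branch. Qed.

Lemma t2_branch : t2 = branch (triple aut_t aut_a 1).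
Proof. by rewrite -triple_conj_a -t1_branch. Qed.

Lemma Gamma_section g s : Gamma g -> Gamma (tree_section g s).
Proof.
move=> Gg; have [G1 GM GV] := Gamma_subgroup.
suff /(_ g Gg): Gamma `<=` [set g | forall s, Gamma (tree_section g s)] by apply.
apply: generated_min; first split=> /= [w|g1 g2 Gg1 Gg2 w|g1 Gg1 w].
- by rewrite section1.
- by rewrite sectionM; apply: GM.
- by rewrite sectionV; apply: GV.
have secA w : Gamma (tree_section aut_a w).
  case: w => [|x w]; first by rewrite section_nil; apply: Gamma_a.
  suff -> : tree_section aut_a (x :: w) = 1 by [].
  by apply: tree_aut_eq => u; rewrite /= /section_fun /= drop_size_cat.
move=> _ [->|->] w //=; elim: w => [|x w IHw].
  by rewrite section_nil; apply: Gamma_t.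
rewrite t0_branch section_branch; elim/letter_ind: x => //=.
by rewrite /triple /= section1.
Qed.

(** The element t^-1 t1 of Gamma' and its conjugates by a have sections a^-1,
    t and t^-1 a, in this cyclic order, so a^-1 and t both occur as sections at
    each letter.  That the lift can be taken in Gamma', and not only in Gamma,
    is what brings Gamma'' into play in at1_Gamma''. *)
Lemma Gamma'_lift x k : Gamma k -> exists2 f, Gamma' (branch f) & f x = k.
Proof.
have [G1 GM GV] := Gamma'_subgroup.
pose S := [set k | exists2 f, Gamma' (branch f) & f x = k].
have sgS : is_subgroup S.
  split=> [|_ _ [f Gf <-] [g Gg <-]|_ [f Gf <-]].
  - by exists (fun=> 1); rewrite ?branch1.
  - by exists (fun y => f y * g y); rewrite -?branchM //; apply: GM.
  - by exists (fun y => (f y)^-1); rewrite -?branchV //; apply: GV.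
have mem_S (f g : letter -> tree_aut) : branch g = branch f ^ aut_a ->
    Gamma (branch f) -> S ((f x)^-1 * g x).
  move=> fg Gf; exists (fun y => (f y)^-1 * g y) => //.
  by rewrite -branchM -branchV fg; apply: mem_commutator; last exact: Gamma_a.
have Gt1 : Gamma t1 by apply: subgroupJ Gamma_subgroup Gamma_a Gamma_t.
have Gt2 : Gamma t2 by apply: subgroupJ Gamma_subgroup Gamma_a Gt1.
have t2J : aut_t = t2 ^ aut_a by rewrite -!conjgM -[_ * _]/(aut_a ^+ 3) aut_a3 conjg1.
have := @mem_S (triple aut_t aut_a 1) (triple aut_a 1 aut_t).
rewrite -t2_branch -t0_branch => /(_ t2J Gt2).
have := @mem_S (triple 1 aut_t aut_a) (triple aut_t aut_a 1).
rewrite -t1_branch -t2_branch => /(_ erefl Gt1).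
have := @mem_S (triple aut_a 1 aut_t) (triple 1 aut_t aut_a).
rewrite -t1_branch -t0_branch => /(_ erefl Gamma_t).
have [_ _ SV] := sgS => Su1 Su2 Su3; move: k; apply: generated_min => //.
suff [Sa St] : S aut_a^-1 /\ S aut_t.
  by move=> _ [->|->] //; rewrite -[aut_a]invgK; apply: SV.
rewrite -[aut_t]mul1g -invg1 -[aut_a^-1]mulg1.
by elim/letter_ind: x @S {sgS mem_S SV} Su1 Su2 Su3.
Qed.

Lemma Gamma_lift x k : Gamma k -> exists2 f, Gamma (branch f) & f x = k.
Proof. by case/(Gamma'_lift x)=> f /Gamma'_sub; exists f. Qed.

(** * Regular branching: the inclusions between Gamma', gamma3 and Gamma'' *)

(** This holds because g ^ h is g times [~ g, h], and g commutes with itself. *)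
Lemma comm_conj_gamma3 g h : Gamma g -> Gamma h -> gamma3 [~ g, g ^ h].
Proof.
move=> Gg Gh; have [_ _ G3V] := gamma3_subgroup.
have -> : [~ g, g ^ h] = [~ [~ g, h], g]^-1 by rewrite /commg /conjg !gnorm.
by apply: G3V; apply: mem_commutator => //; apply: mem_commutator.
Qed.

(** Among t, t1 and t2, any two have sections a and t, in some order, at one
    letter, and at each other letter one of the two sections is trivial.  So
    their commutator is the copy of [~ a, t] or of its inverse below a single
    letter, and the three pairs reach the three letters. *)
Lemma at1_gamma3 x k : Gamma' k -> gamma3 (at1 x k).
Proof.
have [_ _ G3V] := gamma3_subgroup.
suff : Gamma' `<=` [set k | gamma3 (at1 x k)] by apply.
apply: Gamma'_min; first exact: at1_subgroup gamma3_subgroup.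
  move=> h l /(Gamma_lift x)[f Gf <-] /= G3l.
  by rewrite -at1_conj; apply: gamma3_normal.
have Gt1 : Gamma t1 by apply: subgroupJ Gamma_subgroup Gamma_a Gamma_t.
have Ga2 : Gamma (aut_a * aut_a) by have [_ GM _] := Gamma_subgroup; apply: GM; apply: Gamma_a.
have comm_a_t (f g : letter -> tree_aut) : gamma3 [~ branch f, branch g] ->
    (forall y, y <> x -> [~ f y, g y] = 1) -> [~ f x, g x] = [~ aut_a, aut_t] ->
  gamma3 (at1 x [~ aut_a, aut_t]).
  move=> + fg1 <-; rewrite branchR; congr (gamma3 _); apply: branch_ext => y.
  by case: eqP => [-> //|/fg1].
(* The copies at 0, 1 and 2 are [~ t, t2], [~ t2, t1] and [~ t1, t]. *)
elim/letter_ind: x comm_a_t => comm_a_t.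
- apply: (comm_a_t (triple aut_a 1 aut_t) (triple aut_t aut_a 1)) => //.
    rewrite -t0_branch -t2_branch /t2 /t1 -conjgM.
    by apply: comm_conj_gamma3; first exact: Gamma_t.
  by elim/letter_ind => //= _; rewrite /triple /= ?comm1g ?commg1.
- apply: (comm_a_t (triple aut_t aut_a 1) (triple 1 aut_t aut_a)) => //.
    rewrite -t1_branch -t2_branch -invgR; apply: G3V.
    by apply: comm_conj_gamma3 => //; apply: Gamma_a.
  by elim/letter_ind => //= _; rewrite /triple /= ?comm1g ?commg1.
- apply: (comm_a_t (triple 1 aut_t aut_a) (triple aut_a 1 aut_t)) => //.
    rewrite -t1_branch -t0_branch -invgR; apply: G3V.
    by apply: comm_conj_gamma3; [apply: Gamma_t | apply: Gamma_a].
  by elim/letter_ind => //= _; rewrite /triple /= ?comm1g ?commg1.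
Qed.

(** For k in Gamma' and g in Gamma, commuting the copy of k with an element of
    Gamma' whose section at x is g yields the copy of [~ k, g]. *)
Lemma at1_Gamma'' x k : gamma3 k -> Gamma'' (at1 x k).
Proof.
suff : gamma3 `<=` [set k | Gamma'' (at1 x k)] by apply.
apply: commutator_of_min => [|h g Gh /(Gamma'_lift x)[f Gf <-] /=].
  exact: at1_subgroup Gamma''_subgroup.
rewrite -at1_comm; apply: mem_commutator => //.
by apply: gamma3_sub; apply: at1_gamma3.
Qed.

Lemma embed_Gamma' v k : Gamma' k -> Gamma' (embed v k).
Proof. by elim: v => //= x v IHv /IHv Gk; apply: gamma3_sub; apply: at1_gamma3. Qed.

Lemma Gamma'_fix1 g x : Gamma' g -> g [:: x] = [:: x].
Proof.
suff /(_ g) S1 : Gamma' `<=` [set g : tree_aut | forall x, g [:: x] = [:: x]].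
  by move=> /S1.
have Kg h (u : word) : h^-1 (h u) = u by rewrite /= tree_aut_funK.
have letter_word h y : exists z, h [:: y] = [:: z].
  by have := tree_aut_size h [:: y]; case: (h _) => [|z []] //; exists z.
apply: Gamma'_min => [|h k _ k1 y|y].
- split=> //= [h k h1 k1 y|h h1 y]; first by rewrite k1 h1.
  by rewrite -[X in tree_aut_inv_fun _ X]h1 tree_aut_funK.
- rewrite -[LHS]/(h^-1 (k (h [:: y]))).
  by have [z hy] := letter_word h y; rewrite hy k1 -hy Kg.
- have t1w z : aut_t [:: z] = [:: z] by elim/letter_ind: z.
  rewrite -[LHS]/(aut_a^-1 (aut_t^-1 (aut_a (aut_t [:: y])))).
  have tV1w z : aut_t^-1 [:: z] = [:: z] by rewrite -{1}[[:: z]]t1w Kg.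
  rewrite t1w -[aut_a [:: y]]/[:: ordS y] tV1w.
  by rewrite -[[:: ordS y]]/(aut_a [:: y]) Kg.
Qed.

(** * The stabilisers of levels 2 and 3 *)

(** The fibres of the map from Gamma onto its abelianisation, with exponents in
    nat read modulo 3. *)
Definition ab_coset i j : set tree_aut :=
  [set g | exists2 k, Gamma' k & g = aut_a ^+ i * aut_t ^+ j * k].

Lemma ab_cosetM i j i' j' g g' :
  ab_coset i j g -> ab_coset i' j' g' -> ab_coset (i + i') (j + j') (g * g').
Proof.
move=> [k Gk ->] [k' Gk' ->]; have [_ GM _] := Gamma'_subgroup.
have Ga n : Gamma (aut_a ^+ n) := subgroupX n Gamma_subgroup Gamma_a.
have Gt n : Gamma (aut_t ^+ n) := subgroupX n Gamma_subgroup Gamma_t.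
(* The first factor is what moving a ^+ i' to the left of t ^+ j * k, and then
   t ^+ j' to the left of the result, leaves behind. *)
exists (([~ aut_t ^+ j, aut_a ^+ i'] * k ^ (aut_a ^+ i')) ^ (aut_t ^+ j') * k').
  apply: (GM) => //; apply: Gamma'_normal => //; apply: GM.
    exact: mem_commutator.
  exact: Gamma'_normal.
by rewrite !expgnDr /commg /conjg !gnorm.
Qed.

Lemma ab_coset0 k : Gamma' k -> ab_coset 0 0 k.
Proof. by exists k; rewrite // !expg0 !mul1g. Qed.

Lemma ab_cosetV i j g : ab_coset i j g -> ab_coset (2 * i) (2 * j) g^-1.
Proof.
have [G1 GM GV] := Gamma'_subgroup => Gg.
have Gh : ab_coset (2 * i) (2 * j) (aut_a ^+ (2 * i) * aut_t ^+ (2 * j)).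
  by exists 1; rewrite ?mulg1.
have [k Gk] := ab_cosetM Gg Gh.
have exp3 h n : h ^+ 3 = 1 -> h ^+ (n + 2 * n) = 1.
  by move=> h3; rewrite -mulSn expgnA h3 expg1n.
rewrite !exp3 ?aut_a3 ?aut_t3 // !mul1g => ghk.
exists k^-1; first exact: GV.
by rewrite -ghk invgM mulVKg.
Qed.

(** The element t contributes a at 0 and t at 2; its conjugates by powers of a
    contribute cyclic shifts.  So each exponent of an element of the
    stabiliser of the first level shows up twice: once on a and once on t. *)
Definition level1_pattern (f : letter -> tree_aut) : Prop :=
  exists i j m, [/\ ab_coset i j (f letter0), ab_coset j m (f letter1) & ab_coset m i (f letter2)].

Lemma Gamma_pattern g : Gamma g ->
  exists n (f : letter -> tree_aut), g = aut_a ^+ n * branch f /\ level1_pattern f.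
Proof.
have [G1 GM GV] := Gamma_subgroup; have [G'1 _ _] := Gamma'_subgroup.
have patt1 : level1_pattern (fun=> 1) by exists 0, 0, 0; split; apply: ab_coset0.
have pattJ n (f : letter -> tree_aut) : level1_pattern f ->
    exists2 h, branch f ^ (aut_a ^+ n) = branch h & level1_pattern h.
  move=> Pf; elim: n => [|n [h bf [i [j [k [h0 h1 h2]]]]]].
    by exists f; rewrite ?conjg1.
  exists (triple (h letter1) (h letter2) (h letter0)); last by exists j, k, i.
  rewrite expgSr conjgM bf -triple_conj_a; congr (_ ^ _).
  by apply: branch_ext; apply: letter_ind.
move: g; apply: generated_min; first split=> [|g1 g2|g1].
- by exists 0, (fun=> 1); rewrite branch1 mulg1.
- move=> [n [f [-> Pf]]] [m [f' [-> [i' [j' [k' [h0' h1' h2']]]]]]].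
  have [h bf [i [j [k [h0 h1 h2]]]]] := pattJ m f Pf.
  exists (n + m), (fun x => h x * f' x); split.
    by rewrite -branchM -bf expgnDr /conjg !gnorm.
  by exists (i + i'), (j + j'), (k + k'); split; apply: ab_cosetM.
- move=> [n [f [-> Pf]]]; have [h bf [i [j [k [h0 h1 h2]]]]] := pattJ (2 * n)%N f Pf.
  exists (2 * n)%N, (fun x => (h x)^-1); split.
    have -> : aut_a ^+ n = aut_a ^- (2 * n).
      by apply/esym/mulg1_eq; rewrite -expgnDr addnC -mulSn expgnA aut_a3 expg1n.
    by rewrite -branchV -bf /conjg !gnorm.
  by exists (2 * i)%N, (2 * j)%N, (2 * k)%N; split; apply: ab_cosetV.
move=> _ [->|->].
  by exists 1%N, (fun=> 1); rewrite branch1 mulg1.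
exists 0, (triple aut_a 1 aut_t); rewrite mul1g -t0_branch; split=> //.
by exists 1%N, 0, 0; split; exists 1; rewrite ?mul1g ?mulg1.
Qed.

Lemma a_expg_fix n : (aut_a ^+ n) [:: letter0] = [:: letter0] -> 3 %| n.
Proof.
rewrite {1}(divn_eq n 3) mulnC expgnDr expgnA aut_a3 expg1n mul1g /dvdn.
by case: (n %% 3) (ltn_pmod n (isT : 0 < 3)) => [|[|[|]]].
Qed.

Lemma ab_coset_fix1 i j g : ab_coset i j g -> g [:: letter0] = [:: letter0] -> 3 %| i.
Proof.
move=> [k Gk ->]; rewrite -[LHS]/((aut_a ^+ i) ((aut_t ^+ j) (k [:: letter0]))).
rewrite Gamma'_fix1 //; suff -> : (aut_t ^+ j) [:: letter0] = [:: letter0].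
  exact: a_expg_fix.
by elim: j => // j IHj; rewrite expgSr.
Qed.

Lemma ab_coset_dvd i j g : 3 %| i -> 3 %| j -> ab_coset i j g -> Gamma' g.
Proof.
move=> /dvdnP[i' ->] /dvdnP[j' ->] [k Gk ->].
by rewrite ![(_ * 3)%N]mulnC !expgnA aut_a3 aut_t3 !expg1n !mul1g.
Qed.

(** Fixing level 2 kills the exponents of a in all three sections modulo 3,
    and by the pattern those of t as well; so the sections are in Gamma'. *)
Lemma level_stab2_gamma3 : level_stab Gamma 2 `<=` gamma3.
Proof.
move=> g /level_stabP[Gg g2]; have g1 x : g [:: x] = [:: x].
  by apply: (@aut_fix_prefix _ _ [:: letter0]); apply: g2.
have [n [f [gE [i [j [m [f0 f1 f2]]]]]]] := Gamma_pattern Gg.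
have an1 : aut_a ^+ n = 1.
  have /dvdnP[q ->] : 3 %| n.
    by apply: a_expg_fix; rewrite -[RHS](g1 letter0) gE /= aut_nil.
  by rewrite mulnC expgnA aut_a3 expg1n.
rewrite an1 mul1g in gE; have ffix x : f x [:: letter0] = [:: letter0].
  by have := g2 [:: x; letter0] erefl; rewrite gE => -[].
have i3 := ab_coset_fix1 f0 (ffix _); have j3 := ab_coset_fix1 f1 (ffix _).
have m3 := ab_coset_fix1 f2 (ffix _).
rewrite gE; apply: (@branch_closed gamma3); first exact: gamma3_subgroup.
move=> x; apply: at1_gamma3; elim/letter_ind: x.
- exact: ab_coset_dvd i3 j3 f0.
- exact: ab_coset_dvd j3 m3 f1.
- exact: ab_coset_dvd m3 i3 f2.
Qed.

Lemma level_stab3_Gamma'' : level_stab Gamma 3 `<=` Gamma''.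
Proof.
move=> g Gg; apply: (@embed_level_closed 1 gamma3) => [|v k|v v1].
- exact: Gamma''_subgroup.
- by case: v => [|x []] // _; apply: at1_Gamma''.
have [gv Gv] := @level_section Gamma 1 2 v g (fun f s => @Gamma_section f s) v1 Gg.
by split=> //; apply: level_stab2_gamma3.
Qed.

(** * Non-trivial normal subgroups contain level stabilisers *)

Lemma Gamma_transitive v w : size v = size w -> exists2 g, Gamma g & g v = w.
Proof.
have [G1 GM GV] := Gamma_subgroup.
elim: v w => [|x v IHv] [|y w] //= => [_|[/IHv[h Gh hv]]]; first by exists 1.
have [n an] : exists n, forall u, (aut_a ^+ n) (x :: u) = y :: u.
  have : exists n, iter n (@ordS 3) x = y.
    elim/letter_ind: x; elim/letter_ind: y;
    first [by exists 0; apply: val_inj | by exists 1%N; apply: val_inj | by exists 2; apply: val_inj].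
  move=> [n <-]; exists n => u; elim: n => // n IHn.
  by rewrite expgS -[LHS]/(aut_a ((aut_a ^+ n) (x :: u))) IHn.
have [f Gf fy] := Gamma_lift y Gh; exists (branch f * aut_a ^+ n).
  by apply: GM => //; apply: subgroupX Gamma_subgroup Gamma_a.
by rewrite -[LHS]/(branch f ((aut_a ^+ n) (x :: v))) an /= fy hv.
Qed.

(** If g in N moves v, conjugates of g in N move any other vertex of the level of
    v, so N contains the copy of Gamma'' below every vertex of that level; three
    further levels are needed for the sections to be in Gamma''. *)
Lemma normal_level_stab (N : set tree_aut) :
  is_normal_subgroup N Gamma -> N <> [set 1] ->
  exists n, level_stab Gamma n `<=` N.
Proof.
move=> nN N1; have [[[N11 NM NV] NG] nNG] := nN.
have [g [v [Ng gv]]] : exists g v, N g /\ g v <> v.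
  apply: contra_notP N1 => noN; apply/seteqP; split=> [g Ng|_ ->] //=.
  apply: tree_aut_eq => v; apply: contra_notP noN => gv; by exists g, v.
exists (size v + 3) => h Sh.
apply: (@embed_level_closed (size v) Gamma'') => [|w k wv|w wv]; first by [].
  have {g v Ng gv Sh wv} [g Ng gw] : exists2 g, N g & g w <> w.
    have [l Gl lw] := Gamma_transitive wv; exists (g ^ l); first exact: nNG.
    rewrite -[(g ^ l) w]/(l^-1 (g (l w))) lw => /(congr1 l).
    by rewrite lw /= tree_aut_inv_funK.
  suff : Gamma'' `<=` [set k | N (embed w k)] by apply.
  apply: commutator_of_min => [|k1 k2 Gk1 Gk2 /=].
    by split=> /= [|k1 k2|k1]; rewrite ?embed1 ?embedM ?embedV //;
      [exact: NM | exact: NV].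
  by apply: normal_embed_commutator nN Ng gw _ _; apply: Gamma'_sub; apply: embed_Gamma'.
have [hw Shw] := @level_section Gamma _ 3 w h (fun f s => @Gamma_section f s) wv Sh.
by split=> //; apply: level_stab3_Gamma''.
Qed.

(** * Infiniteness, fractality and regular branching *)

(** If Gamma had n elements, the orbit of a word of length n would have at most
    n elements, while by transitivity it has 3 ^ n. *)
Lemma Gamma_infinite : infinite_set Gamma.
Proof.
move=> /finite_seqP[r Gr]; set n := size r.
pose base := nseq n letter0.
have uniq_words : uniq [seq tval b | b <- enum {: n.-tuple letter}].
  by rewrite map_inj_uniq ?enum_uniq //; apply: val_inj.
have : {subset [seq tval b | b <- enum {: n.-tuple letter}] <= [seq (g : tree_aut) base | g <- r]}.
  move=> _ /mapP[w _ ->].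
  have [|g Gg <-] := @Gamma_transitive base (tval w).
    by rewrite size_nseq size_tuple.
  by apply: map_f; move: Gg; rewrite Gr.
move=> /(uniq_leq_size uniq_words); rewrite !size_map -enumT -cardT card_tuple card_ord.
by rewrite leqNgt ltn_expl.
Qed.

Lemma Gamma_fractal : fractal Gamma.
Proof.
move=> s; apply/seteqP; split=> [_ [g [Gg gs] <-]|k]; first exact: Gamma_section.
elim: s k => [|x s IHs] k Gk; first by exists k; rewrite ?section_nil //; split=> //; apply: aut_nil.
have [h [Gh hs] hk] := IHs k Gk; have [f Gf fx] := Gamma_lift x Gh.
exists (branch f); last by rewrite section_branch fx.
by split; rewrite //= fx hs.
Qed.

Lemma Gamma'_branch : regular_branch_over Gamma Gamma'.
Proof.
split.
- by split; [split; [exact: Gamma'_subgroup | exact: Gamma'_sub] | exact: Gamma'_normal].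
- move=> g Gg; apply/level_stabP; split; first exact: Gamma'_sub.
  by move=> [|x []] // _; apply: Gamma'_fix1.
- apply: (@finite_index_level_stab _ _ 2 Gamma_subgroup Gamma'_subgroup).
  by move=> g /level_stab2_gamma3/gamma3_sub.
move=> [[k0 k1] k2] [[/= Gk0 Gk1] Gk2]; exists (branch (triple k0 k1 k2)).
  apply: (@branch_closed Gamma'); first exact: Gamma'_subgroup.
  by move=> x; apply: gamma3_sub; apply: at1_gamma3; elim/letter_ind: x.
by rewrite /phi !section_branch !section_nil.
Qed.

Theorem proposition6p2 :
  just_infinite Gamma /\
  fractal Gamma /\
  regular_branch_over Gamma (commutator_subgroup Gamma) /\
  congruence_property Gamma.
Proof.
split.
  split; first exact: Gamma_infinite.
  move=> N nN /(normal_level_stab nN)[n].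
  by apply: finite_index_level_stab => //; [exact: Gamma_subgroup | case: nN => -[]].
split; first exact: Gamma_fractal.
split; first exact: Gamma'_branch.
move=> H sgH fH.
have [n Sn] := normal_level_stab (normal_core_normal Gamma_subgroup sgH)
  (normal_core_nontrivial Gamma_infinite Gamma_subgroup sgH fH).
exists n => g /Sn /(_ 1); rewrite conjg1; apply.
by have [] := Gamma_subgroup.
Qed.
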